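(* Let $\mathbb{K}\in\{\mathbb{R},\mathbb{C}\}$, let $A\in\mathbb{K}^{n\times n}$ be self-adjoint with eigenvalues $\lambda_1\ge\dots\ge\lambda_n$ (counted with multiplicity), set $\lambda_0:=\infty$, and let $A=X\Lambda X^*$ be an eigendecomposition with $\Lambda=\mathrm{diag}(\lambda_1,\dots,\lambda_n)$ and $X$ unitary with columns $x_1,\dots,x_n$. Let $\mathcal{X}_\ell=\mathrm{span}\{x_1,\dots,x_\ell\}$ for $1\le \ell\le n$, and $\mathcal{X}_0=\{0\}$. Let $0\le j<h<k\le \mathrm{rank}(A)$, with $k<n$, be such that $\lambda_j>\lambda_{j+1}$ and $\lambda_k>\lambda_{k+1}$. Let $\mathcal{T}\subset\mathbb{K}^n$ be a subspace with $t:=\dim\mathcal{T}\ge h$ and such that $\Theta(\mathcal{X}_k,\mathcal{T})<\frac{\pi}{2}I_{\min\{t,k\}}$ (i.e. all principal angles between $\mathcal{X}_k$ and $\mathcal{T}$ are strictly smaller than $\pi/2$). Then, for every unitarily invariant norm $\|\cdot\|$, $$d(\Lambda\text{-adm}_h(A),\mathcal{T})\le \|\sin\Theta(\mathcal{X}_j,\mathcal{T})\|+\|\sin\Theta(\mathcal{X}_k,\mathcal{T})\|.$$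
   Context: Principal angles: for subspaces $\mathcal{S},\mathcal{T}\subset\mathbb{K}^n$, let $S,T$ be matrices with orthonormal columns spanning $\mathcal{S},\mathcal{T}$, and let $m=\min\{\dim\mathcal{S},\dim\mathcal{T}\}$. The principal angles $0\le\theta_1(\mathcal{S},\mathcal{T})\le\dots\le\theta_m(\mathcal{S},\mathcal{T})\le\pi/2$ are determined by $\cos\theta_i(\mathcal{S},\mathcal{T})=\sigma_i(S^*T)$ (singular values in non-increasing order), and $\Theta(\mathcal{S},\mathcal{T})=\mathrm{diag}(\theta_1,\dots,\theta_m)$; if one subspace is $\{0\}$, $\Theta(\mathcal{S},\mathcal{T})=0$. The matrix $\sin\Theta$ is the diagonal matrix of the sines of the principal angles. A unitarily invariant norm is a norm on $\mathbb{K}^{n\times n}$ with $\|UMV\|=\|M\|$ for all $M$ and all unitary (orthogonal if $\mathbb{K}=\mathbb{R}$) $U,V$; it is evaluated at smaller matrices by padding them with zeros to size $n\times n$. $\Lambda$-admissible subspaces (with respect to the fixed indices $j,k$): $\Lambda\text{-adm}_h(A)=\{\mathcal{S}\subset\mathbb{K}^n \text{ subspace}: \dim\mathcal{S}=h,\ \mathcal{X}_j\subseteq\mathcal{S}\subseteq\mathcal{X}_k\}$. Because of the gaps at $j$ and $k$, $\mathcal{X}_j$ and $\mathcal{X}_k$ do not depend on the choice of eigendecomposition. The distance is $d(\Lambda\text{-adm}_h(A),\mathcal{T})=\inf\{\|\sin\Theta(\mathcal{S},\mathcal{T})\|:\mathcal{S}\in\Lambda\text{-adm}_h(A)\}$.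 *)

(* Defs.v *)
From HB Require Import structures.
From mathcomp Require Import all_boot all_order all_algebra.
From mathcomp Require Import all_classical all_reals all_analysis.
From mathcomp Require Import complex.

Set Implicit Arguments.
Unset Strict Implicit.
Unset Printing Implicit Defensive.

Import Order.TTheory GRing.Theory Num.Theory.
Local Open Scope classical_set_scope.
Local Open Scope ring_scope.

Inductive base_field := RealScalars | ComplexScalars.

Definition scalar_field (R : realType) (F : base_field) : numFieldType :=
  match F with RealScalars => R | ComplexScalars => R[i] end.

Definition conjK (R : realType) (F : base_field) : scalar_field R F -> scalar_field R F :=
  match F with RealScalars => fun a => a | ComplexScalars => @conjc R end.

Definition absK (R : realType) (F : base_field) : scalar_field R F -> R :=
  match F with
  | RealScalars => fun a : R => `|a|
  | ComplexScalars => @Normc.normc R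
  end.

Definition ofR (R : realType) (F : base_field) : R -> scalar_field R F :=
  match F with
  | RealScalars => fun a => a
  | ComplexScalars => fun a => real_complex R a
  end.

Section Definitions.
Variables (R : realType) (F : base_field).
Local Notation K := (scalar_field R F).

Definition adjmx p q (M : 'M[K]_(p, q)) : 'M[K]_(q, p) :=
  (map_mx (@conjK R F) M)^T.

Definition orthonormal_cols p q (M : 'M[K]_(p, q)) : Prop :=
  adjmx M *m M = 1%:M.

(* For a square matrix, U^* U = 1 already gives U U^* = 1. *)
Definition unitary n (U : 'M[K]_n) : Prop := orthonormal_cols U.

(* Here s has length min(p, q); nth's default value is never reached. *)
Definition singular_values p q (M : 'M[K]_(p, q)) (s : seq R) : Prop :=
  [/\ size s = minn p q,
      sorted >=%R s,
      all (fun x => 0 <= x) s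
    & exists (U : 'M[K]_p) (V : 'M[K]_q),
        [/\ unitary U, unitary V
          & M = U *m (\matrix_(i < p, l < q)
                        if (i == l :> nat) then ofR F s`_i else 0)
                  *m adjmx V]].

Definition colspan n p (M : 'M[K]_(n, p)) : {vspace 'cV[K]_n} :=
  (\sum_(i < p) <[col i M]>)%VS.

Definition principal_angles n (S T : {vspace 'cV[K]_n}) (th : seq R) : Prop :=
  exists (MS : 'M[K]_(n, \dim S)) (MT : 'M[K]_(n, \dim T)),
    [/\ orthonormal_cols MS /\ colspan MS = S,
        orthonormal_cols MT /\ colspan MT = T,
        sorted <=%R th,
        all (fun x => 0 <= x <= pi / 2) th
      & singular_values (adjmx MS *m MT) [seq cos x | x <- th]].

(* The diagonal of the matrix Theta(S, T), of length min(dim S, dim T). The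
   sequence satisfying principal_angles exists and is unique, so neither the
   choice nor the default value matters. *)
Definition Theta n (S T : {vspace 'cV[K]_n}) : seq R :=
  xget [::] [set th | principal_angles S T th].

(* sin Theta(S, T), already padded with zeros to size n: beyond the last
   principal angle, nth returns 0 and sin 0 = 0. *)
Definition sinTheta n (S T : {vspace 'cV[K]_n}) : 'M[K]_n :=
  diag_mx (\row_(i < n) ofR F (sin (Theta S T)`_i)).

Definition unitarily_invariant_norm n (nu : 'M[K]_n -> R) : Prop :=
  [/\ forall M, 0 <= nu M,
      forall M, nu M = 0 -> M = 0,
      forall a M, nu (a *: M) = absK a * nu M,
      forall M N, nu (M + N) <= nu M + nu N
    & forall U M V, unitary U -> unitary V -> nu (U *m M *m V) = nu M].

(* One-based: eigval lam l is lambda_l for 1 <= l <= n, and lambda_0 = +oo. *)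
Definition eigval n (lam : n.-tuple R) (l : nat) : \bar R :=
  if l is l'.+1 then (lam`_l')%:E else +oo%E.

Definition eigendecomposition n (A X : 'M[K]_n) (lam : n.-tuple R) : Prop :=
  [/\ sorted >=%R lam,
      unitary X
    & A = X *m diag_mx (\row_(i < n) ofR F (tnth lam i)) *m adjmx X].

Definition leading_span n (X : 'M[K]_n) (l : nat) : {vspace 'cV[K]_n} :=
  (\sum_(i < n | (i < l)%N) <[col i X]>)%VS.

(* The admissible subspaces depend on A only through its eigenvector matrix X;
   when j and k sit at spectral gaps they do not depend on the choice of X. *)
Definition Lambda_adm n (X : 'M[K]_n) (j h k : nat) : set {vspace 'cV[K]_n} :=
  [set S : {vspace 'cV[K]_n} | [/\ \dim S = h,
             (leading_span X j <= S)%VS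
           & (S <= leading_span X k)%VS]].

Definition adm_dist n (nu : 'M[K]_n -> R) (D : set {vspace 'cV[K]_n})
    (T : {vspace 'cV[K]_n}) : R :=
  inf [set nu (sinTheta S T) | S in D].

End Definitions.

(* Main.v *)
(** Let [P_S] denote the orthogonal projector onto [S].  If [dim S <= dim T],
    the norm of [sin Theta(S, T)] is that of [(1 - P_T) P_S], and multiplying by
    a projector does not increase a unitarily invariant norm.  Let
    [t = dim T].  If [k <= t], then [S = X_h] works, as
    [(1 - P_T) P_S = (1 - P_T) P_(X_k) P_S].  If [t < k], put [T' = P_(X_k) T];
    the angle condition gives [dim T' = t], and [T'] has the same angles with
    [T] as [X_k].  Dimension counting yields [S'] of dimension [h - j] in [T']
    and orthogonal to [X_j]; then [S = X_j + S'] is admissible,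
    [P_S = P_(X_j) + P_S'], and the triangle inequality concludes. *)

Require Import Defs.
From HB Require Import structures.
From mathcomp Require Import all_boot all_order perm all_algebra.
From mathcomp Require Import all_classical all_reals all_analysis.
From mathcomp Require Import complex lra.

Set Implicit Arguments.
Unset Strict Implicit.
Unset Printing Implicit Defensive.

Import Order.TTheory GRing.Theory Num.Theory.
Local Open Scope ring_scope.

(** * Conjugation, modulus and the embedding of the reals, uniformly for real and complex scalars *)

Section ScalarField.
Variables (R : realType) (F : base_field).
Local Notation K := (scalar_field R F).

Lemma conjK_is_zmod_morphism : zmod_morphism (@conjK R F).
Proof. by case: F => // x y /=; rewrite rmorphB. Qed.

Lemma conjK_is_monoid_morphism : monoid_morphism (@conjK R F).
Proof. by case: F; split=> [|x y] //; rewrite /conjK /ofR ?rmorph1 ?rmorphM. Qed.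

HB.instance Definition _ :=
  GRing.isZmodMorphism.Build K K (@conjK R F) conjK_is_zmod_morphism.
HB.instance Definition _ :=
  GRing.isMonoidMorphism.Build K K (@conjK R F) conjK_is_monoid_morphism.

Lemma ofR_is_zmod_morphism : zmod_morphism (@ofR R F).
Proof. by case: F => // x y /=; rewrite rmorphB. Qed.

Lemma ofR_is_monoid_morphism : monoid_morphism (@ofR R F).
Proof. by case: F; split=> [|x y] //; rewrite /conjK /ofR ?rmorph1 ?rmorphM. Qed.

HB.instance Definition _ :=
  GRing.isZmodMorphism.Build R K (@ofR R F) ofR_is_zmod_morphism.
HB.instance Definition _ :=
  GRing.isMonoidMorphism.Build R K (@ofR R F) ofR_is_monoid_morphism.

Lemma conjK_involutive : involutive (@conjK R F).
Proof. by case: F => //; exact: conjcK. Qed.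

Lemma conjK_ofR (r : R) : conjK (ofR F r) = ofR F r.
Proof. by case: F => //; exact: conjc_real. Qed.

Lemma conjK_fixed (a : K) : conjK a = a -> exists r, a = ofR F r.
Proof.
case: F a => [a _|]; first by exists a.
case=> x y /= [/eqP]; rewrite eq_sym -addr_eq0 -mulr2n mulrn_eq0 /= => /eqP ->.
by exists x.
Qed.

Lemma absK_ofR (r : R) : absK (ofR F r) = `|r|.
Proof.
by case: F => //=; rewrite /Normc.normc /= expr0n addr0 sqrtr_sqr.
Qed.

Lemma mul_conjK (a : K) : conjK a * a = ofR F (absK a ^+ 2).
Proof.
case: F a => [a|] /=; first by rewrite real_normK ?num_real ?expr2.
case=> x y /=; rewrite sqr_sqrtr ?addr_ge0 ?sqr_ge0 //.
by apply/eqP; rewrite eq_complex /= !expr2 mulNr opprK mulNr [y * x]mulrC subrr !eqxx.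
Qed.

Lemma absK_eq0 (a : K) : absK a = 0 -> a = 0.
Proof. by case: F a => [a /normr0_eq0|a /Normc.eq0_normc]. Qed.

End ScalarField.

(** * Unitary completion and eigenvectors of self-adjoint matrices *)

Section Adjoint.
Variables (R : realType) (F : base_field).
Local Notation K := (scalar_field R F).

Lemma adjmxE p q (M : 'M[K]_(p, q)) i l : adjmx M i l = conjK (M l i).
Proof. by rewrite /adjmx mxE mxE. Qed.

Lemma adjmxK p q (M : 'M[K]_(p, q)) : adjmx (adjmx M) = M.
Proof. by apply/matrixP => i l; rewrite !adjmxE conjK_involutive. Qed.

Lemma adjmxM p q r (M : 'M[K]_(p, q)) (N : 'M[K]_(q, r)) :
  adjmx (M *m N) = adjmx N *m adjmx M.
Proof. by rewrite /adjmx map_mxM trmx_mul. Qed.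

Lemma adjmxD p q (M N : 'M[K]_(p, q)) : adjmx (M + N) = adjmx M + adjmx N.
Proof. by rewrite /adjmx map_mxD raddfD. Qed.

Lemma adjmxN p q (M : 'M[K]_(p, q)) : adjmx (- M) = - adjmx M.
Proof. by rewrite /adjmx map_mxN raddfN. Qed.

Lemma adjmxZ p q (a : K) (M : 'M[K]_(p, q)) :
  adjmx (a *: M) = conjK a *: adjmx M.
Proof. by apply/matrixP => i l; rewrite [RHS]mxE !adjmxE mxE rmorphM. Qed.

Lemma adjmx1 n : adjmx (1%:M : 'M[K]_n) = 1%:M.
Proof. by rewrite /adjmx map_mx1 trmx1. Qed.

Lemma adjmx_diag n (d : 'rV[R]_n) :
  adjmx (diag_mx (map_mx (@ofR R F) d)) = diag_mx (map_mx (@ofR R F) d).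
Proof.
rewrite /adjmx map_diag_mx tr_diag_mx -map_mx_comp.
by congr diag_mx; apply/rowP => i; rewrite !mxE /= conjK_ofR.
Qed.

Lemma gramE p q (M : 'M[K]_(p, q)) i l :
  (adjmx M *m M) i l = \sum_a conjK (M a i) * M a l.
Proof. by rewrite mxE; apply: eq_bigr => a _; rewrite adjmxE. Qed.

Lemma gram_diagE p q (M : 'M[K]_(p, q)) i :
  (adjmx M *m M) i i = ofR F (\sum_a absK (M a i) ^+ 2).
Proof. by rewrite gramE rmorph_sum; apply: eq_bigr => a _; exact: mul_conjK. Qed.

(** The diagonal entry is the sum of the squared moduli of the column. *)
Lemma gram_diag_eq0 p q (M : 'M[K]_(p, q)) i :
  (adjmx M *m M) i i = 0 -> forall a, M a i = 0.
Proof.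
rewrite gram_diagE => /eqP; rewrite fmorph_eq0 psumr_eq0; last first.
  by move=> a _; exact: sqr_ge0.
move=> /allP M0 a; apply/absK_eq0/eqP; rewrite -sqrf_eq0.
exact: (M0 a (mem_index_enum a)).
Qed.

Lemma gram_col_neq0 p (v : 'cV[K]_p) : v != 0 -> (adjmx v *m v) 0 0 != 0.
Proof.
apply: contraNneq => /gram_diag_eq0 v0; apply/eqP/matrixP => a b.
by rewrite (ord1 b) v0 mxE.
Qed.

Lemma normalize_col p (v : 'cV[K]_p) :
  v != 0 -> exists c : K, orthonormal_cols (c *: v).
Proof.
move=> /gram_col_neq0; set s := \sum_a absK (v a 0) ^+ 2.
rewrite gram_diagE -/s fmorph_eq0 => s0.
have s_ge0 : 0 <= s by apply: sumr_ge0 => a _; exact: sqr_ge0.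
exists (ofR F (Num.sqrt s)^-1); apply/matrixP => a b.
rewrite (ord1 a) (ord1 b) adjmxZ -scalemxAl -scalemxAr [RHS]mxE [LHS]mxE.
rewrite [X in _ * X]mxE gram_diagE -/s conjK_ofR -!rmorphM mulrA -expr2.
by rewrite exprVn sqr_sqrtr // mulVf // rmorph1.
Qed.

Lemma unitary_adj n (U : 'M[K]_n) : unitary U -> U *m adjmx U = 1%:M.
Proof. exact: mulmx1C. Qed.

Lemma unitary_adjmx n (U : 'M[K]_n) : unitary U -> unitary (adjmx U).
Proof. by move=> uU; rewrite /unitary /orthonormal_cols adjmxK unitary_adj. Qed.

Lemma orthonormal_colsM p q r (M : 'M[K]_(p, q)) (N : 'M[K]_(q, r)) :
  orthonormal_cols M -> orthonormal_cols N -> orthonormal_cols (M *m N).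
Proof.
move=> oM oN; rewrite /orthonormal_cols adjmxM mulmxA -(mulmxA (adjmx N)) oM.
by rewrite mulmx1.
Qed.

(** Induction on the number of columns outside [P]: one of them is replaced by a unit vector
    orthogonal to the columns in [P], and its index joins [P]. *)
Lemma complete_unitary n (M : 'M[K]_n) (P : {set 'I_n}) :
    {in P &, forall i l, (adjmx M *m M) i l = (i == l)%:R} ->
  exists2 Z : 'M[K]_n, unitary Z & {in P, forall i a, Z a i = M a i}.
Proof.
move: {2}#|_| (erefl #|~: P|) => m.
elim: m P M => [|m IHm] P M cardP oM.
  have PT : P = [set: 'I_n] by rewrite -(finset.setCK P) (cards0_eq cardP) finset.setC0.
  by exists M => //; apply/matrixP => i l; rewrite oM ?PT ?inE // mxE.
have /card_gt0P[i0] : (0 < #|~: P|)%N by rewrite cardP.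
rewrite inE => i0P.
(* Column [i0] of [N] is zero, so [N] is singular; a left null vector, transposed, is orthogonal to
   every column of [M] indexed by [P]. *)
pose N := \matrix_(a, i) if i \in P then conjK (M a i) else 0.
have : \det N == 0.
  rewrite (expand_det_col _ i0) big1 // => a _.
  by rewrite mxE (negbTE i0P) mul0r.
case/det0P => v v0 vN.
have vM i : i \in P -> \sum_a conjK (M a i) * v 0 a = 0.
  move=> iP; transitivity ((v *m N) 0 i); last by rewrite vN mxE.
  rewrite mxE.
  by apply: eq_bigr => a _; rewrite mxE iP mulrC.
have [c] : exists c : K, orthonormal_cols (c *: v^T).
  by apply: normalize_col; rewrite trmx_eq0.
set w := c *: v^T => ow.
have Mw i : i \in P -> \sum_a conjK (M a i) * w a 0 = 0.
  move=> iP; rewrite (eq_bigr (fun a => c * (conjK (M a i) * v 0 a))).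
    by rewrite -mulr_sumr vM // mulr0.
  by move=> a _; rewrite !mxE mulrCA.
clearbody w; pose M' := \matrix_(a, i) if i == i0 then w a 0 else M a i.
have [||Z uZ ZM'] := IHm (i0 |: P) M'.
- apply/eqP; rewrite finset.setCU -(eqn_add2l 1) !add1n -cardP; apply/eqP.
  by rewrite finset.setIC -finset.setDE [in RHS](cardsD1 i0) inE i0P.
- move=> i l; rewrite !in_setU1 gramE.
  under eq_bigr do rewrite !mxE.
  have [->|ni] := eqVneq i i0; have [->|nl] := eqVneq l i0 => //= iP lP.
  + by have /matrixP/(_ 0 0) := ow; rewrite gramE mxE eqxx.
  (* This product is the conjugate of the one that [Mw] shows to vanish. *)
  + rewrite -[LHS]conjK_involutive rmorph_sum.
    under eq_bigr do rewrite rmorphM /= conjK_involutive mulrC.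
    by rewrite Mw // rmorph0.
  + by rewrite Mw // (negbTE ni).
  + by rewrite -oM // gramE.
exists Z => // i iP a; rewrite ZM' ?inE ?iP ?orbT // mxE.
by case: eqVneq iP i0P => // -> ->.
Qed.

(** Rectangular form, obtained by padding [M] with zero columns. The set [D] makes it possible to
    discard degenerate columns. *)
Lemma complete_unitary_cols p q (M : 'M[K]_(p, q)) (D : {set 'I_q})
    (le_qp : (q <= p)%N) :
    {in D &, forall i l, (adjmx M *m M) i l = (i == l)%:R} ->
  exists2 Z : 'M[K]_p, unitary Z & {in D, forall i a, Z a (widen_ord le_qp i) = M a i}.
Proof.
move=> oM; pose N : 'M[K]_p := \matrix_(a, l)
  if insub (l : nat) is Some i then M a i else 0.
have NE a i : N a (widen_ord le_qp i) = M a i by rewrite mxE /= (valK i).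
have [|Z uZ ZN] := @complete_unitary _ N [set widen_ord le_qp i | i in D].
  move=> _ _ /imsetP[i iD ->] /imsetP[l lD ->].
  by rewrite gramE; under eq_bigr do rewrite !NE; rewrite -gramE oM.
by exists Z => // i iD a; rewrite ZN ?NE //; apply/imsetP; exists i.
Qed.

End Adjoint.

(** Evaluating [v^* H v] in two ways gives [conj(a) |v|^2 = a |v|^2] with [|v|^2] nonzero, so
    conjugation fixes [a]. *)
Lemma selfadjoint_eigenvalue_real (R : realType) (F : base_field) n
    (H : 'M[scalar_field R F]_n) (v : 'cV_n) (a : scalar_field R F) :
  adjmx H = H -> v != 0 -> H *m v = a *: v -> exists r, a = ofR F r.
Proof.
move=> hH v0 Hv; apply: conjK_fixed.
have /matrixP/(_ 0 0) : adjmx (H *m v) *m v = adjmx v *m (H *m v).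
  by rewrite adjmxM hH mulmxA.
rewrite Hv adjmxZ -scalemxAl -scalemxAr [LHS]mxE [RHS]mxE => /mulIf; apply.
exact: gram_col_neq0.
Qed.

Lemma selfadjoint_eigenvector_complex (R : realType) n
    (H : 'M[scalar_field R ComplexScalars]_n.+1) :
  adjmx H = H ->
  exists (r : R) (v : 'cV_n.+1), v != 0 /\ H *m v = ofR ComplexScalars r *: v.
Proof.
(* [eigenvalue] speaks of row vectors, whence the transposes. *)
move=> hH; have [a] := @eigenvalue_closed R[i] _ H^T isT.
case/eigenvalueP => v vH v0.
have v0' : v^T != 0 by rewrite trmx_eq0.
have Hv : H *m v^T = a *: v^T by rewrite -[H]trmxK -trmx_mul vH linearZ.
have [r ra] := selfadjoint_eigenvalue_real hH v0' Hv.
by exists r, v^T; rewrite -ra.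
Qed.

(** Seen as a complex matrix, [H] has a real eigenvalue. It is a root of the characteristic
    polynomial, which has real coefficients, so a real eigenvector exists too. *)
Lemma selfadjoint_eigenvector_real (R : realType) n
    (H : 'M[scalar_field R RealScalars]_n.+1) :
  adjmx H = H ->
  exists (r : R) (v : 'cV_n.+1), v != 0 /\ H *m v = ofR RealScalars r *: v.
Proof.
move=> hH; pose G : 'M[scalar_field R ComplexScalars]_n.+1 := map_mx (real_complex R) H.
have hG : adjmx G = G.
  apply/matrixP => i l; rewrite adjmxE !mxE; apply: etrans (conjc_real _) _.
  by congr (real_complex R _); have /matrixP/(_ i l) := hH; rewrite adjmxE.
have [r [v [v0 Gv]]] := selfadjoint_eigenvector_complex hG.
have /(@eigenvalueP R[i]) : exists2 u : 'rV_n.+1, u *m G^T = (r%:C)%C *: u & u != 0.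
  exists v^T; last by rewrite trmx_eq0.
  by rewrite -trmx_mul Gv linearZ.
rewrite eigenvalue_root_char /G map_trmx -map_char_poly fmorph_root.
rewrite -eigenvalue_root_char => /eigenvalueP[u uH u0].
exists r, u^T; split; first by rewrite trmx_eq0.
by rewrite -[H]trmxK -trmx_mul uH linearZ.
Qed.

Lemma selfadjoint_eigenvector (R : realType) (F : base_field) n
    (H : 'M[scalar_field R F]_n.+1) :
  adjmx H = H -> exists (r : R) (v : 'cV_n.+1), v != 0 /\ H *m v = ofR F r *: v.
Proof.
case: F H => H; [exact: selfadjoint_eigenvector_real|].
exact: selfadjoint_eigenvector_complex.
Qed.

(** * Spectral theorem and singular values *)

Section SingularValues.
Variables (R : realType) (F : base_field).
Local Notation K := (scalar_field R F).
Local Notation rdiag d := (diag_mx (map_mx (@ofR R F) d)).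

(** Deflation: a unit eigenvector is completed to a unitary [Z]. Then [Z^* H Z] is block diagonal,
    and the induction hypothesis applies to its lower block. *)
Lemma selfadjoint_diagonalization n (H : 'M[K]_n) :
  adjmx H = H ->
  exists (U : 'M[K]_n) (d : 'rV[R]_n), unitary U /\ H = U *m rdiag d *m adjmx U.
Proof.
elim: n H => [|n IHn] H hH.
  by exists 1%:M, 0; split; apply/matrixP => -[].
have [r [v [v0 Hv]]] := selfadjoint_eigenvector hH.
have [c oc] := normalize_col v0.
have {v0 Hv} Hcv : H *m (c *: v) = ofR F r *: (c *: v).
  by rewrite -scalemxAr Hv !scalerA mulrC.
move: (c *: v) oc Hcv => w ow Hw.
(* All columns of the given matrix are [w], but only column [0] is retained. *)
have [|Z uZ Zw] := @complete_unitary _ _ _ (\matrix_(a, i) w a 0) [set 0 : 'I_n.+1].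
  move=> i l; rewrite !inE => /eqP -> /eqP ->; rewrite gramE.
  under eq_bigr do rewrite !mxE.
  by have /matrixP/(_ 0 0) := ow; rewrite gramE mxE eqxx.
have {}Zw : col 0 Z = w.
  by apply/matrixP => a b; rewrite mxE Zw ?inE // mxE (ord1 b).
pose G : 'M[K]_(1 + n) := adjmx Z *m H *m Z.
have hG : adjmx G = G by rewrite /G !adjmxM adjmxK hH mulmxA.
have HG : H = Z *m G *m adjmx Z.
  by rewrite /G !mulmxA unitary_adj // mul1mx -mulmxA unitary_adj // mulmx1.
have G0 i : G i 0 = if i == 0 then ofR F r else 0.
  have : col 0 G = ofR F r *: col 0 (1%:M : 'M[K]_n.+1).
    by rewrite colE -!mulmxA -colE Zw Hw -scalemxAr -Zw !colE mulmxA uZ.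
  move=> /matrixP/(_ i 0); rewrite [LHS]mxE => ->; rewrite !mxE.
  by case: eqP => _; rewrite ?mulr1 ?mulr0.
(* Self-adjointness carries the zeros of the first column over to the first row. *)
have G0r i : G 0 i = if i == 0 then ofR F r else 0.
  rewrite -hG adjmxE G0; case: eqP => _; first exact: conjK_ofR.
  by rewrite rmorph0.
clearbody G.
have lshiftE (i : 'I_1) : lshift n i = 0 by apply/val_inj; rewrite (ord1 i).
have rshift_neq0 (i : 'I_n) : (rshift 1 i == 0 :> 'I_(1 + n)) = false by [].
have GE : G = block_mx (ofR F r)%:M 0 0 (drsubmx G).
  rewrite -[LHS]submxK; congr block_mx; apply/matrixP => a b; rewrite !mxE ?lshiftE.
  - by rewrite G0 eqxx (ord1 a) (ord1 b).
  - by rewrite G0r rshift_neq0.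
  - by rewrite G0 rshift_neq0.
have [|U [d [uU dG]]] := IHn (drsubmx G).
  by rewrite -{2}hG; apply/matrixP => a b; rewrite adjmxE !mxE.
pose B : 'M[K]_(1 + n) := block_mx 1%:M 0 0 U.
pose e : 'rV[R]_(1 + n) := row_mx r%:M d.
have adjB : adjmx B = block_mx 1%:M 0 0 (adjmx U).
  by rewrite /adjmx map_block_mx tr_block_mx map_mx1 trmx1 !map_mx0 !trmx0.
have uB : unitary B.
  rewrite /unitary /orthonormal_cols adjB mulmx_block.
  by rewrite !mul0mx !mulmx0 !addr0 add0r mulmx1 uU -scalar_mx_block.
have GB : G = B *m rdiag e *m adjmx B.
  rewrite adjB [LHS]GE [in LHS]dG map_row_mx diag_mx_row !mulmx_block.
  rewrite !mul0mx !mulmx0 !addr0 !add0r !mul0mx !mul1mx !mulmx1; congr block_mx.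
  by apply/matrixP => a b; rewrite !mxE (ord1 a) (ord1 b) !eqxx !mulr1n.
exists (Z *m B), e; split; first exact: orthonormal_colsM.
by rewrite HG GB adjmxM !mulmxA.
Qed.

Lemma mul_diag_adjmxE p q r (U : 'M[K]_(p, r)) (V : 'M[K]_(q, r)) (e : 'rV[K]_r) a b :
  (U *m diag_mx e *m adjmx V) a b = \sum_i U a i * e 0 i * conjK (V b i).
Proof. by rewrite mxE; apply: eq_bigr => i _; rewrite adjmxE mul_mx_diag mxE. Qed.

(** Permuting the eigenvalues and the columns of [U] alike only reorders the spectral sum. *)
Lemma selfadjoint_diagonalization_sorted n (H : 'M[K]_n) :
  adjmx H = H ->
  exists (U : 'M[K]_n) (d : 'rV[R]_n),
    [/\ unitary U, H = U *m rdiag d *m adjmx U &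
        forall i l : 'I_n, (i <= l)%N -> d 0 l <= d 0 i].
Proof.
move=> /selfadjoint_diagonalization[U [d [uU HE]]].
pose t := [tuple d 0 i | i < n].
have /tuple_permP[s ts] : perm_eq (sort >=%R t) t by rewrite perm_sort.
exists (\matrix_(a, i) U a (s i)), (\row_i d 0 (s i)); split.
- apply/matrixP => i l; rewrite gramE; under eq_bigr do rewrite !mxE.
  by rewrite -gramE uU !mxE (inj_eq perm_inj).
- apply/matrixP => a b; rewrite HE !mul_diag_adjmxE.
  rewrite (reindex_inj (@perm_inj _ s)) /=.
  by apply: eq_bigr => i _; rewrite !mxE.
move=> i l il; rewrite !mxE.
have sE (o : 'I_n) : d 0 (s o) = (sort >=%R t)`_o.
  by rewrite ts -tnth_nth !tnth_mktuple.
have ht : sorted >=%R (sort >=%R t) by apply: sort_sorted => x y; exact: le_total.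
rewrite !sE; apply: (sorted_leq_nth _ _ _ ht) => //.
- by move=> y x z /= yx zy; exact: le_trans zy yx.
- by move=> x /=.
- by rewrite inE size_sort size_tuple.
- by rewrite inE size_sort size_tuple.
Qed.

(** The columns of [N] are orthogonal with squared lengths [d_i^2]. Those with [d_i] nonzero are
    divided by [d_i] and completed to a unitary matrix; the others are zero, so any column of [W]
    serves. *)
Lemma diagonal_gram_factorization p q (N : 'M[K]_(p, q)) (d : 'rV[R]_q)
    (le_qp : (q <= p)%N) :
  adjmx N *m N = rdiag (map_mx (fun x => x ^+ 2) d) ->
  exists2 W : 'M[K]_p, unitary W &
    forall a i, N a i = W a (widen_ord le_qp i) * ofR F (d 0 i).
Proof.
move=> NN.
pose D := [set i | d 0 i != 0].
have [|W uW WN] :=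
    @complete_unitary_cols _ _ _ _ (\matrix_(a, i) (N a i * ofR F (d 0 i)^-1)) D le_qp.
  move=> i l; rewrite !inE => i0 l0; rewrite gramE.
  under eq_bigr => a _ do rewrite !mxE rmorphM /= conjK_ofR mulrACA.
  rewrite -mulr_suml -gramE NN !mxE.
  have [->|_] := eqVneq i l; last by rewrite mulr0n mul0r.
  by rewrite mulr1n -!rmorphM expr2 mulrACA divff // mulr1 rmorph1.
exists W => // a i; have [d0|d0] := eqVneq (d 0 i) 0.
  rewrite d0 rmorph0 mulr0; apply: gram_diag_eq0.
  by rewrite NN !mxE eqxx d0 expr0n rmorph0.
by rewrite WN ?inE // mxE -mulrA -rmorphM mulVf // rmorph1 mulr1.
Qed.

(** Name for the middle factor in [singular_values]. *)
Definition rect_diag p q (s : seq R) : 'M[K]_(p, q) :=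
  \matrix_(i < p, l < q) if (i == l :> nat) then ofR F s`_i else 0.

Lemma adjmx_rect_diag p q s : adjmx (rect_diag p q s) = rect_diag q p s.
Proof.
apply/matrixP => i l; rewrite adjmxE !mxE eq_sym.
by case: eqP => [->|_]; rewrite ?conjK_ofR ?rmorph0.
Qed.

Lemma singular_values_adjmx p q (M : 'M[K]_(p, q)) s :
  singular_values M s -> singular_values (adjmx M) s.
Proof.
case=> sz srt s0 [U [V [uU uV ->]]]; split; rewrite 1?minnC //.
exists V, U; split=> //; rewrite -/(rect_diag p q s) !adjmxM adjmxK.
by rewrite adjmx_rect_diag mulmxA.
Qed.

(** If [V] diagonalizes [M^* M], then [M V] has a diagonal Gram matrix and factors through a unitary
    [W]. The singular values are the square roots of the eigenvalues. *)
Lemma singular_values_exist_tall p q (M : 'M[K]_(p, q)) :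
  (q <= p)%N -> exists s, singular_values M s.
Proof.
move=> le_qp.
have [V [e [uV He srt]]] : exists (V : 'M[K]_q) (e : 'rV[R]_q),
    [/\ unitary V, adjmx M *m M = V *m rdiag e *m adjmx V &
        forall i l : 'I_q, (i <= l)%N -> e 0 l <= e 0 i].
  by apply: selfadjoint_diagonalization_sorted; rewrite adjmxM adjmxK.
pose N := M *m V.
have NN : adjmx N *m N = rdiag e.
  rewrite adjmxM mulmxA -(mulmxA _ _ M) He !mulmxA uV mul1mx -mulmxA.
  by rewrite uV mulmx1.
have e0 i : 0 <= e 0 i.
  have : (adjmx N *m N) i i = ofR F (e 0 i) by rewrite NN !mxE eqxx mulr1n.
  rewrite gram_diagE => /fmorph_inj <-.
  by apply: sumr_ge0 => a _; exact: sqr_ge0.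
pose d : 'rV[R]_q := map_mx Num.sqrt e.
have [|W uW NW] := @diagonal_gram_factorization _ _ N d le_qp.
  rewrite NN; congr (diag_mx (map_mx _ _)); apply/rowP => i.
  by rewrite !mxE sqr_sqrtr.
pose s := [seq d 0 i | i <- enum 'I_q].
have sE (i : 'I_q) : s`_i = d 0 i.
  by rewrite (nth_map i) ?size_enum_ord // nth_ord_enum.
have szs : size s = q by rewrite size_map size_enum_ord.
exists s; split.
- by rewrite szs; apply/esym/minn_idPr.
- apply/(sortedP 0) => i; rewrite szs => iq.
  rewrite (sE (Ordinal iq)) (sE (Ordinal (ltnW iq))) !mxE /=.
  by rewrite ler_wsqrtr // srt /=.
- by apply/allP => x /mapP[i _ ->]; rewrite mxE sqrtr_ge0.
exists W, V; split=> //; rewrite -/(rect_diag p q s).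
have -> : W *m rect_diag p q s = N.
  apply/matrixP => a l; rewrite mxE (bigD1 (widen_ord le_qp l)) //= mxE eqxx /=.
  rewrite sE -NW big1 ?addr0 // => i; rewrite -val_eqE /= => il.
  by rewrite mxE (negbTE il) mulr0.
by rewrite -mulmxA unitary_adj // mulmx1.
Qed.

Lemma singular_values_exist p q (M : 'M[K]_(p, q)) : exists s, singular_values M s.
Proof.
have [|/ltnW] := leqP q p; first exact: singular_values_exist_tall.
move=> /(singular_values_exist_tall (adjmx M))[s /singular_values_adjmx].
by rewrite adjmxK; exists s.
Qed.

End SingularValues.

(** * Orthogonal projectors *)

Section Projection.
Variables (R : realType) (F : base_field).
Local Notation K := (scalar_field R F).

(** Stated through the action on vectors, so that no basis of [S] has to be chosen. *)
Definition orthogonal_projector n (P : 'M[K]_n) (S : {vspace 'cV[K]_n}) : Prop :=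
  [/\ adjmx P = P, forall w, P *m w \in S & forall v, v \in S -> P *m v = v].

Lemma mulmx_col_inj p q (M N : 'M[K]_(p, q)) :
  (forall v : 'cV_q, M *m v = N *m v) -> M = N.
Proof.
move=> MN; apply/matrixP => a i.
by have /matrixP/(_ a 0) := MN (delta_mx i 0); rewrite -!colE !mxE.
Qed.

Lemma projector_idem n (P : 'M[K]_n) S : orthogonal_projector P S -> P *m P = P.
Proof. by case=> _ PS idP; apply: mulmx_col_inj => v; rewrite -mulmxA idP. Qed.

Lemma projector_absorb n (P Q : 'M[K]_n) S T :
  orthogonal_projector P S -> orthogonal_projector Q T -> (S <= T)%VS -> Q *m P = P.
Proof.
move=> [_ PS _] [_ _ idQ] /subvP ST.
by apply: mulmx_col_inj => v; rewrite -mulmxA idQ // ST.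
Qed.

(** Absorption both ways gives [P = Q P = (P Q)^* = Q^* = Q]. *)
Lemma projector_unique n (P Q : 'M[K]_n) S :
  orthogonal_projector P S -> orthogonal_projector Q S -> P = Q.
Proof.
move=> pP pQ; have QP := projector_absorb pP pQ (subvv S).
have PQ := projector_absorb pQ pP (subvv S).
by case: pP pQ => hP _ _ [hQ _ _]; rewrite -QP -{1}hQ -{1}hP -adjmxM PQ.
Qed.

Lemma mulmx_sum_col n p (M : 'M[K]_(n, p)) (y : 'cV_p) :
  M *m y = \sum_i y i 0 *: col i M.
Proof.
apply/matrixP => a b; rewrite mxE summxE (ord1 b).
by apply: eq_bigr => i _; rewrite !mxE mulrC.
Qed.

Lemma memv_colspan n p (M : 'M[K]_(n, p)) v :
  reflect (exists y, v = M *m y) (v \in colspan M).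
Proof.
apply: (iffP memv_sumP) => [[vs vsM ->]|[y ->]].
  have vsE i : exists a, vs i = a *: col i M by apply/vlineP/vsM.
  have [y yE] := choice vsE.
  exists (\col_i y i); rewrite mulmx_sum_col.
  by apply: eq_bigr => i _; rewrite yE mxE.
exists (fun i => y i 0 *: col i M); last exact: mulmx_sum_col.
by move=> i _; rewrite memvZ // memv_line.
Qed.

Lemma colspan_projector n p (M : 'M[K]_(n, p)) :
  orthonormal_cols M -> orthogonal_projector (M *m adjmx M) (colspan M).
Proof.
move=> oM; split; first by rewrite adjmxM adjmxK.
  by move=> w; apply/memv_colspan; exists (adjmx M *m w); rewrite mulmxA.
by move=> _ /memv_colspan[y ->]; rewrite -!mulmxA (mulmxA (adjmx M)) oM mul1mx.
Qed.

Lemma dim_colspan n p (M : 'M[K]_(n, p)) :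
  orthonormal_cols M -> \dim (colspan M) = p.
Proof.
move=> oM; pose X := [tuple col i M | i < p].
have <- : <<X>>%VS = colspan M.
  by rewrite span_def big_tuple; apply: eq_bigr => i _; rewrite tnth_mktuple.
suff /eqP -> : free X by rewrite size_tuple.
apply/freeP => k; under eq_bigr do rewrite -tnth_nth tnth_mktuple.
have -> : \sum_i k i *: col i M = M *m \col_i k i.
  by rewrite mulmx_sum_col; apply: eq_bigr => i _; rewrite mxE.
move=> /(congr1 (mulmx (adjmx M))); rewrite mulmxA oM mul1mx mulmx0.
by move=> /colP k0 i; have := k0 i; rewrite !mxE.
Qed.

Lemma dimv_le n (S : {vspace 'cV[K]_n}) : (\dim S <= n)%N.
Proof. by rewrite (leq_trans (dimvS (subvf S))) // dimvf /dim /= muln1. Qed.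

(** Orthonormalization through the Gram matrix: if [B] holds a basis and [B^* B = V e V^*], then
    [B V e^(-1/2)] has orthonormal columns and the same span. *)
Lemma orthonormal_basis_exists n (S : {vspace 'cV[K]_n}) :
  exists2 M : 'M[K]_(n, \dim S), orthonormal_cols M & colspan M = S.
Proof.
pose B : 'M[K]_(n, \dim S) := \matrix_(a, i) (vbasis S)`_i a 0.
have By (y : 'cV_(\dim S)) : B *m y = \sum_i y i 0 *: (vbasis S)`_i.
  rewrite mulmx_sum_col; apply: eq_bigr => i _; congr (_ *: _).
  by apply/matrixP => a b; rewrite !mxE (ord1 b).
have injB (y : 'cV_(\dim S)) : B *m y = 0 -> y = 0.
  rewrite By => /(freeP (basis_free (vbasisP S))) y0.
  by apply/colP => i; rewrite y0 mxE.
have [V [e [uV BB]]] : exists (V : 'M[K]_(\dim S)) (e : 'rV[R]_(\dim S)),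
    unitary V /\ adjmx B *m B = V *m diag_mx (map_mx (@ofR R F) e) *m adjmx V.
  by apply: selfadjoint_diagonalization; rewrite adjmxM adjmxK.
pose N := B *m V.
have NN : adjmx N *m N = diag_mx (map_mx (@ofR R F) e).
  rewrite adjmxM mulmxA -(mulmxA _ _ B) BB !mulmxA uV mul1mx -mulmxA.
  by rewrite uV mulmx1.
(* [e_i] is the squared length of [B] applied to column [i] of [V], a nonzero vector, and [B] is
   injective. *)
have e_gt0 i : 0 < e 0 i.
  have NNi : (adjmx N *m N) i i = ofR F (e 0 i) by rewrite NN !mxE eqxx mulr1n.
  rewrite lt_def; apply/andP; split.
    apply/eqP => ei0; have V0 : col i V = 0.
      apply: injB; rewrite colE mulmxA -/N -colE; apply/colP => a.
      rewrite !mxE; have := @gram_diag_eq0 _ _ _ _ N i; rewrite NNi ei0 rmorph0.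
      by move=> /(_ erefl a); rewrite mxE.
    have /matrixP/(_ i i) := uV; rewrite gramE big1 ?mxE ?eqxx => [/eqP|a _].
      by rewrite eq_sym oner_eq0.
    by have /colP/(_ a) := V0; rewrite !mxE => ->; rewrite mulr0.
  move: NNi; rewrite gram_diagE => /fmorph_inj <-.
  by apply: sumr_ge0 => a _; exact: sqr_ge0.
pose d : 'rV[R]_(\dim S) := map_mx Num.sqrt e.
have d0 i : d 0 i != 0 by rewrite mxE gt_eqF // sqrtr_gt0.
pose D := diag_mx (map_mx (@ofR R F) (map_mx (fun x => x^-1) d)).
exists (N *m D).
  rewrite /orthonormal_cols adjmxM adjmx_diag mulmxA -(mulmxA _ _ N) NN.
  rewrite -!mulmxA !mul_diag_mx; apply/matrixP => i l; rewrite !mxE.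
  have [->|_] := eqVneq i l; last by rewrite !(mulr0n, mul0r, mulr0).
  rewrite !mulr1n -!rmorphM; have := d0 l; rewrite mxE.
  have := sqr_sqrtr (ltW (e_gt0 l)); move: (Num.sqrt _) => x <- x0.
  by rewrite expr2 mulfK // mulVf // rmorph1.
apply/vspaceP => v; apply/memv_colspan/idP => [[y ->]|vS].
  rewrite -!mulmxA By; apply: memv_suml => i _.
  by rewrite memvZ // vbasis_mem // mem_nth // size_tuple.
(* These coefficients undo [D] and [V], leaving [B] applied to the coordinates of [v]. *)
exists (diag_mx (map_mx (@ofR R F) d) *m (adjmx V *m \col_i coord (vbasis S) i v)).
have DD : D *m diag_mx (map_mx (@ofR R F) d) = 1%:M.
  rewrite mul_diag_mx; apply/matrixP => i l; rewrite !mxE.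
  have [->|_] := eqVneq i l; last by rewrite !(mulr0n, mulr0).
  have := d0 l; rewrite mxE => dl0.
  by rewrite !mulr1n -rmorphM mulVf // rmorph1.
rewrite mulmxA -(mulmxA N) DD mulmx1 mulmxA -(mulmxA B) unitary_adj // mulmx1.
by rewrite By {1}(coord_vbasis vS); apply: eq_bigr => i _; rewrite mxE.
Qed.

Lemma projector_exists n (S : {vspace 'cV[K]_n}) :
  exists P, orthogonal_projector P S.
Proof.
have [M oM <-] := orthonormal_basis_exists S.
by exists (M *m adjmx M); exact: colspan_projector.
Qed.

End Projection.

(** * Principal angles and unitarily invariant norms *)

Section Angles.
Variables (R : realType) (F : base_field).
Local Notation K := (scalar_field R F).
Local Notation rdiag d := (diag_mx (map_mx (@ofR R F) d)).

(** The difference of the [i]-th columns of [M] and [N] has squared length [2 - 2 s_i], which is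
    nonnegative. *)
Lemma rect_diag_le1 n p q (M : 'M[K]_(n, p)) (N : 'M[K]_(n, q)) s :
    orthonormal_cols M -> orthonormal_cols N ->
    adjmx M *m N = rect_diag F p q s ->
  forall i, (i < minn p q)%N -> s`_i <= 1.
Proof.
move=> oM oN MN i; rewrite leq_min => /andP[ip iq].
pose a : 'I_p := Ordinal ip; pose b : 'I_q := Ordinal iq.
have MNab : (adjmx M *m N) a b = ofR F s`_i by rewrite MN mxE eqxx.
have NMba : (adjmx N *m M) b a = ofR F s`_i.
  by rewrite -(adjmxK M) -adjmxM adjmxE MNab conjK_ofR.
pose w := col a M - col b N.
have : (adjmx w *m w) 0 0 = ofR F (1 - s`_i - (s`_i - 1)).
  rewrite !rmorphB rmorph1 /= -{1}MNab -NMba.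
  have M1 : (adjmx M *m M) a a = 1 by rewrite oM mxE eqxx.
  have N1 : (adjmx N *m N) b b = 1 by rewrite oN mxE eqxx.
  rewrite -{1}M1 -N1.
  rewrite !mxE -!sumrB; apply: eq_bigr => c _; rewrite !adjmxE !mxE rmorphB.
  by rewrite mulrBl !mulrBr.
rewrite gram_diagE => /fmorph_inj w2.
have : 0 <= \sum_c absK (w c 0) ^+ 2 by apply: sumr_ge0 => c _; exact: sqr_ge0.
by rewrite w2; lra.
Qed.

Lemma acos_mono : {in `[(-1 : R), 1] &, {mono @acos R : x y /~ x <= y}}.
Proof.
move=> x y xI yI; have [x1 y1] := (acos_def xI, acos_def yI).
by rewrite leNgt -ltr_cos ?in_itv ?x1.1 ?y1.1 // x1.2 y1.2 -leNgt.
Qed.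

Lemma acos_in_quadrant (x : R) : 0 <= x <= 1 -> 0 <= acos x <= pi / 2.
Proof.
case/andP=> x0 x1; have xI : -1 <= x <= 1 by rewrite x1 andbT (le_trans _ x0) // lerN10.
rewrite acos_ge0 //= -acos0 acos_mono //.
by rewrite in_itv /= lerN10 ler01.
Qed.

Lemma principal_angles_exist n (S T : {vspace 'cV[K]_n}) :
  exists th, principal_angles S T th.
Proof.
have [MS oMS MSS] := orthonormal_basis_exists S.
have [MT oMT MTT] := orthonormal_basis_exists T.
have [s sv] := singular_values_exist (adjmx MS *m MT).
(* Absorbing [U] and [V] into the orthonormal bases makes the matrix of inner products diagonal;
   [rect_diag_le1] then bounds its entries. *)
have s01 x : x \in s -> 0 <= x <= 1.
  have [sz _ /allP s0 [U [V [uU uV AE]]]] := sv.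
  move=> xs; rewrite s0 //=; rewrite -(nth_index 0 xs).
  apply: (@rect_diag_le1 _ _ _ (MS *m U) (MT *m V)); try exact: orthonormal_colsM.
    rewrite adjmxM mulmxA -(mulmxA _ _ MT) AE !mulmxA uU mul1mx -mulmxA uV.
    by rewrite mulmx1.
  by rewrite -sz index_mem.
have cosK' : [seq cos x | x <- [seq acos x | x <- s]] = s.
  rewrite -map_comp -[RHS]map_id; apply/eq_in_map => x /s01 /andP[x0 x1] /=.
  by rewrite acosK // in_itv /= x1 andbT (le_trans _ x0) // lerN10.
exists [seq acos x | x <- s], MS, MT; split=> //.
- have [_ srt _ _] := sv.
  apply/(sortedP 0) => i; rewrite size_map => ilt.
  have s_itv m : (m < size s)%N -> s`_m \in `[(-1 : R), 1].
    move=> /(mem_nth 0)/s01/andP[x0 x1].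
    by rewrite in_itv /= x1 andbT (le_trans _ x0) // lerN10.
  rewrite !(nth_map 0) ?(ltnW ilt) // acos_mono ?s_itv ?(ltnW ilt) //.
  exact: (sortedP 0 srt).
- by apply/allP => _ /mapP[x /s01 x01 ->]; exact: acos_in_quadrant.
- by rewrite cosK'.
Qed.

Lemma principal_angles_sym n (S T : {vspace 'cV[K]_n}) th :
  principal_angles S T th -> principal_angles T S th.
Proof.
case=> MS [MT [hS hT srt bd sv]]; exists MT, MS; split=> //.
by rewrite -(adjmxK MS) -adjmxM; exact: singular_values_adjmx.
Qed.

Lemma ThetaP n (S T : {vspace 'cV[K]_n}) : principal_angles S T (Theta S T).
Proof. by apply: xgetPex; exact: principal_angles_exist. Qed.

(** Both sets of angle sequences are equal, so [xget] picks the same element. *)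
Lemma Theta_sym n (S T : {vspace 'cV[K]_n}) : Theta S T = Theta T S.
Proof.
rewrite /Theta; congr (xget _ _); apply/seteqP.
by split=> th; exact: principal_angles_sym.
Qed.

Lemma sinTheta_sym n (S T : {vspace 'cV[K]_n}) : sinTheta S T = sinTheta T S.
Proof. by rewrite /sinTheta Theta_sym. Qed.

(** In bases adapted to the singular value decomposition, [P] acts on [T] as the rectangular matrix
    of cosines. As [dim T <= dim S], each coordinate [z_i] meets a cosine, which is positive, so the
    kernel is trivial. *)
Lemma projector_kernel_trivial n (S T : {vspace 'cV[K]_n}) (P : 'M[K]_n) v :
    orthogonal_projector P S -> (\dim T <= \dim S)%N ->
    all (fun th => th < pi / 2) (Theta S T) ->
  v \in T -> P *m v = 0 -> v = 0.
Proof.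
move=> pP le_TS lt_th vT Pv.
have [MS [MT [[oS SE] [oT TE] srt /allP bd]]] := ThetaP S T.
case=> sz _ _ [U [V [uU uV AE]]].
have PE : P = MS *m adjmx MS.
  by have := colspan_projector oS; rewrite SE; exact: projector_unique.
move: vT; rewrite -{1}TE => /memv_colspan[y vE].
have : rect_diag F (\dim S) (\dim T) [seq cos x | x <- Theta S T] *m (adjmx V *m y) = 0.
  have -> : rect_diag F (\dim S) (\dim T) [seq cos x | x <- Theta S T]
            = adjmx U *m (adjmx MS *m MT) *m V.
    by rewrite AE !mulmxA uU mul1mx -mulmxA uV mulmx1.
  rewrite -!mulmxA (mulmxA V) unitary_adj // mul1mx -vE.
  have -> : adjmx MS *m v = adjmx MS *m (P *m v).
    by rewrite PE !mulmxA oS mul1mx.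
  by rewrite Pv !mulmx0.
have [z zE] : exists z, z = adjmx V *m y by exists (adjmx V *m y).
rewrite -zE => Cz.
have z0 : z = 0.
  apply/colP => i; have /colP/(_ (widen_ord le_TS i)) := Cz.
  rewrite !mxE (bigD1 i) //= mxE eqxx big1 => [|l]; last first.
    by rewrite -val_eqE /= eq_sym mxE => /negbTE ->; rewrite mul0r.
  rewrite addr0 => /eqP; rewrite mulf_eq0 fmorph_eq0 => /orP[|/eqP //].
  have ith : (i < size (Theta S T))%N.
    by rewrite -(size_map (@cos R)) sz (minn_idPr le_TS).
  have thi := mem_nth 0 ith.
  rewrite (nth_map 0) // gt_eqF // cos_gt0_pihalf //.
  rewrite (allP lt_th) // andbT (lt_le_trans _ (proj1 (andP (bd _ thi)))) //.
  by rewrite oppr_lt0 divr_gt0 ?pi_gt0.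
by rewrite vE -(mul1mx y) -(unitary_adj uV) -mulmxA -zE z0 !mulmx0.
Qed.

Lemma sum_widen_ord p n (le_pn : (p <= n)%N) (G : 'I_n -> K) :
  (forall i : 'I_n, (p <= i)%N -> G i = 0) -> \sum_i G i = \sum_i G (widen_ord le_pn i).
Proof.
move=> G0; rewrite -(big_ord_narrow le_pn (F := G)) [RHS]big_mkcond /=.
by apply: eq_bigr => i _; case: ltnP => // /G0.
Qed.

Variables (n : nat) (nu : 'M[K]_n -> R).
Hypothesis nu_norm : unitarily_invariant_norm nu.

Lemma unitary1 : unitary (1%:M : 'M[K]_n).
Proof. by rewrite /unitary /orthonormal_cols adjmx1 mul1mx. Qed.

(** The Gram matrix yields [M = W d Z^*] with [W] unitary, and invariance removes [W] and [Z]. *)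
Lemma norm_gram_diag (M Z : 'M[K]_n) (d : 'rV[R]_n) :
    unitary Z ->
    adjmx M *m M = Z *m rdiag (map_mx (fun x => x ^+ 2) d) *m adjmx Z ->
  nu M = nu (rdiag d).
Proof.
move=> uZ ME; have [_ _ _ _ inv] := nu_norm.
have [|W uW MZ] := diagonal_gram_factorization (N := M *m Z) (d := d) (leqnn n).
  by rewrite adjmxM mulmxA -(mulmxA _ _ M) ME !mulmxA uZ mul1mx -mulmxA uZ mulmx1.
have <- : W *m rdiag d *m adjmx Z = M.
  have -> : W *m rdiag d = M *m Z.
    apply/matrixP => a i; rewrite mul_mx_diag MZ !mxE.
    by congr (W a _ * _); apply: val_inj.
  by rewrite -mulmxA unitary_adj // mulmx1.
by rewrite inv //; exact: unitary_adjmx.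
Qed.

Lemma norm_sinTheta (S T : {vspace 'cV[K]_n}) (P Q : 'M[K]_n) :
    (\dim S <= \dim T)%N -> orthogonal_projector P S -> orthogonal_projector Q T ->
  nu (sinTheta S T) = nu ((1%:M - Q) *m P).
Proof.
move=> le_ST pP pQ.
have [MS [MT [[oS SE] [oT TE] _ _]]] := ThetaP S T.
set th := Theta S T; case=> sz _ _ [U [V [uU uV]]].
rewrite -/(rect_diag F _ _ _); set C := rect_diag F _ _ _ => AE.
have szth : size th = \dim S by rewrite -(minn_idPl le_ST) -sz size_map.
have PE : P = MS *m adjmx MS.
  by have := colspan_projector oS; rewrite SE; exact: projector_unique.
have QE : Q = MT *m adjmx MT.
  by have := colspan_projector oT; rewrite TE; exact: projector_unique.
pose B := MS *m U; have oB : orthonormal_cols B by exact: orthonormal_colsM.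
pose d : 'rV[R]_n := \row_i sin th`_i.
have -> : sinTheta S T = rdiag d.
  by congr diag_mx; apply/rowP => i; rewrite !mxE.
have [|Z uZ ZB] :=
    @complete_unitary_cols _ _ _ _ B [set: 'I_(\dim S)] (dimv_le S).
  by move=> i l _ _; rewrite oB mxE.
apply/esym/(norm_gram_diag uZ).
pose e : 'rV[R]_(\dim S) := \row_i sin th`_i.
(* Because [dim S <= dim T], every row of [C] contains a cosine. *)
have CC : 1%:M - C *m adjmx C = rdiag (map_mx (fun x => x ^+ 2) e).
  apply/matrixP => i l; rewrite adjmx_rect_diag !mxE.
  rewrite (bigD1 (widen_ord le_ST l)) //= big1 => [|m]; last first.
    rewrite -val_eqE /= => /negbTE ml.
    by rewrite [X in _ * X]mxE ml mulr0.
  rewrite addr0 !mxE eqxx -val_eqE /=; case: eqVneq => [il|_]; last first.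
    by rewrite mul0r subr0.
  rewrite il (nth_map 0) ?szth // !mulr1n sin2cos2 rmorphB rmorph1 rmorphXn.
  by rewrite expr2.
have QQ := projector_idem pQ; have PP := projector_idem pP.
have [hP _ _] := pP; have [hQ _ _] := pQ.
have -> : adjmx ((1%:M - Q) *m P) *m ((1%:M - Q) *m P) =
    B *m (1%:M - C *m adjmx C) *m adjmx B.
  have hQ1 : adjmx (1%:M - Q) = 1%:M - Q by rewrite adjmxD adjmxN adjmx1 hQ.
  have QQ1 : (1%:M - Q) *m (1%:M - Q) = 1%:M - Q.
    by rewrite mulmxBl mul1mx mulmxBr mulmx1 QQ subrr subr0.
  rewrite adjmxM hP hQ1 mulmxA -(mulmxA P) QQ1.
  rewrite !mulmxBr !mulmxBl !mulmx1 PP /B adjmxM; congr (_ - _).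
    by rewrite !mulmxA -(mulmxA MS) unitary_adj // mulmx1.
  have -> : P *m Q *m P = MS *m (adjmx MS *m MT) *m adjmx (adjmx MS *m MT) *m adjmx MS.
    by rewrite PE QE adjmxM adjmxK !mulmxA.
  rewrite AE !adjmxM adjmxK !mulmxA -(mulmxA _ (adjmx V) V) uV mulmx1.
  by [].
(* The extra columns of [Z] have weight [0]: beyond the last angle [nth] returns [0], and
   [sin 0 = 0]. *)
rewrite CC; apply/matrixP => a b; rewrite !mul_diag_adjmxE.
rewrite [RHS](sum_widen_ord (dimv_le S)) => [|i pi].
  by apply: eq_bigr => i _; rewrite !ZB ?inE // !mxE.
by rewrite !mxE nth_default ?szth // sin0 expr0n rmorph0 mulr0 mul0r.
Qed.

(* A projector P is the mean of the unitary matrices 1 and 2P - 1. *)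
Lemma norm_mul_projector (M P : 'M[K]_n) (S : {vspace 'cV[K]_n}) :
  orthogonal_projector P S -> nu (M *m P) <= nu M.
Proof.
move=> pP; have PP := projector_idem pP; have [hP _ _] := pP.
have [nu0 _ nuZ nuD inv] := nu_norm.
pose C := 1%:M - P.
have hC : adjmx C = C by rewrite adjmxD adjmxN adjmx1 hP.
have PDC : P + C = 1%:M by rewrite addrC subrK.
have PC : P *m C = 0 by rewrite mulmxBr mulmx1 PP subrr.
have CP : C *m P = 0 by rewrite mulmxBl mul1mx PP subrr.
have CC : C *m C = C by rewrite {1}/C mulmxBl mul1mx PC subr0.
clearbody C; pose U := P - C.
have uU : unitary U.
  rewrite /unitary /orthonormal_cols adjmxD adjmxN hP hC.
  by rewrite mulmxBl !mulmxBr PP PC CP CC subr0 sub0r opprK.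
have -> : M *m P = ofR F 2^-1 *: (M + M *m U).
  rewrite -{2}(mulmx1 M) -PDC mulmxDr mulmxBr addrACA subrr addr0 -mulr2n.
  rewrite -[M *m P *+ 2]scaler_nat scalerA -(rmorph_nat (@ofR R F)) -rmorphM.
  by rewrite mulVf ?pnatr_eq0 // rmorph1 scale1r.
rewrite nuZ absK_ofR ger0_norm ?invr_ge0 ?ler0n // mulrC ler_pdivrMr ?ltr0n //.
rewrite mulr_natr mulr2n (le_trans (nuD _ _)) // lerD2l.
by rewrite -{1}(mul1mx M) inv //; exact: unitary1.
Qed.

End Angles.

(** * Admissible subspaces *)

Section Subspaces.
Variables (R : realType) (F : base_field) (n : nat).
Local Notation K := (scalar_field R F).
Implicit Types (P Q : 'M[K]_n) (S T : {vspace 'cV[K]_n}).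

Lemma subspace_of_dim S m :
  (m <= \dim S)%N -> exists2 S', (S' <= S)%VS & \dim S' = m.
Proof.
move=> mS; exists <<take m (vbasis S)>>%VS.
  by apply/span_subvP => v /mem_take; exact: vbasis_mem.
have: free (take m (vbasis S) ++ drop m (vbasis S)).
  by rewrite cat_take_drop (basis_free (vbasisP S)).
by move=> /catl_free/eqP ->; rewrite size_take_min size_tuple; apply/minn_idPl.
Qed.

Lemma leading_span_colspan (X : 'M[K]_n) l :
    unitary X -> (l <= n)%N ->
  exists2 M : 'M[K]_(n, l), orthonormal_cols M & colspan M = leading_span X l.
Proof.
move=> uX le_ln; exists (\matrix_(a, i) X a (widen_ord le_ln i)).
  apply/matrixP => i m; rewrite gramE; under eq_bigr do rewrite !mxE.
  by rewrite -gramE uX !mxE.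
rewrite /leading_span (big_ord_narrow le_ln); apply: eq_bigr => i _.
by congr (<[_]>%VS); apply/colP => a; rewrite !mxE.
Qed.

Lemma dim_leading_span (X : 'M[K]_n) l :
  unitary X -> (l <= n)%N -> \dim (leading_span X l) = l.
Proof.
by move=> uX le_ln; have [M oM <-] := leading_span_colspan uX le_ln; exact: dim_colspan.
Qed.

Lemma leading_span_mono (X : 'M[K]_n) l m :
  (l <= m)%N -> (leading_span X l <= leading_span X m)%VS.
Proof.
move=> lm; apply/subv_sumP => i il.
by rewrite (sumv_sup i) // (leq_trans il).
Qed.

Lemma memv_lker_mulmx P (v : 'cV[K]_n) :
  (v \in lker (linfun (mulmx P))) = (P *m v == 0).
Proof. by rewrite memv_ker lfunE. Qed.

(** The inclusion of [T] in the kernel of [P] encodes orthogonality to [S]. It gives [P Q = 0], and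
    [Q P = 0] by taking adjoints. *)
Lemma projector_add P Q S T :
    orthogonal_projector P S -> orthogonal_projector Q T ->
    (T <= lker (linfun (mulmx P)))%VS ->
  orthogonal_projector (P + Q) (S + T)%VS.
Proof.
move=> [hP PS idP] [hQ QT idQ] /subvP TP.
have PQ : P *m Q = 0.
  apply: mulmx_col_inj => v; rewrite -mulmxA mul0mx; apply/eqP.
  by rewrite -memv_lker_mulmx TP.
have QP : Q *m P = 0 by rewrite -hQ -hP -adjmxM PQ /adjmx map_mx0 trmx0.
split; first by rewrite adjmxD hP hQ.
  by move=> w; rewrite mulmxDl memv_add.
move=> _ /memv_addP[x xS [y yT ->]].
have Py : P *m y = 0 by apply/eqP; rewrite -memv_lker_mulmx TP.
have Qx : Q *m x = 0 by rewrite -(idP x xS) mulmxA QP mul0mx.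
by rewrite mulmxDl !mulmxDr (idP x xS) (idQ y yT) Py Qx addr0 add0r.
Qed.

Lemma dim_add_ker P S T :
    orthogonal_projector P S -> (T <= lker (linfun (mulmx P)))%VS ->
  \dim (S + T) = (\dim S + \dim T)%N.
Proof.
move=> [_ _ idP] /subvP TP; apply: dimv_disjoint_sum; apply/eqP; rewrite -subv0.
apply/subvP => v; rewrite memv_cap memv0 => /andP[/idP {2}<- /TP].
by rewrite memv_lker_mulmx.
Qed.

(* The image T' of T under P satisfies P_T' P_T = P P_T, so that the angles
   between S and T are those between T' and T. *)
Lemma norm_sinTheta_image (nu : 'M[K]_n -> R) P Q Q' S T :
    unitarily_invariant_norm nu -> orthogonal_projector P S ->
    orthogonal_projector Q T -> (\dim T <= \dim S)%N ->
    let T' := (linfun (mulmx P) @: T)%VS in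
    \dim T' = \dim T -> orthogonal_projector Q' T' ->
  nu (sinTheta S T) = nu ((1%:M - Q) *m Q').
Proof.
move=> nu_norm pP pQ le_TS T' dimT' pQ'.
have T'S : (T' <= S)%VS.
  by apply/subvP => _ /memv_imgP[w _ ->]; rewrite lfunE; case: pP => _ + _; exact.
have Q'P : Q' *m P = Q'.
  have PQ' := projector_absorb pQ' pP T'S.
  by case: pP pQ' => hP _ _ [hQ' _ _]; rewrite -{1}hQ' -{1}hP -adjmxM PQ'.
have Q'Q : Q' *m Q = P *m Q.
  apply: mulmx_col_inj => v; rewrite -!mulmxA -{1}Q'P -mulmxA.
  case: pQ' => _ _; apply; apply/memv_imgP; exists (Q *m v); last by rewrite lfunE.
  by case: pQ => _ + _; exact.
(* The norm is that of [(1 - P) Q = (1 - Q') Q]; since [dim T' = dim T], the roles of [T] and [T']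
   can be exchanged. *)
rewrite sinTheta_sym (norm_sinTheta nu_norm le_TS pQ pP) mulmxBl -Q'Q -mulmxBl.
by rewrite -(norm_sinTheta nu_norm _ pQ pQ') ?dimT' // sinTheta_sym
  (norm_sinTheta nu_norm _ pQ' pQ) ?dimT'.
Qed.

End Subspaces.

Theorem theorem4p2 (R : realType) (F : base_field) (n : nat)
    (A X : 'M[scalar_field R F]_n) (lam : n.-tuple R) (j h k : nat)
    (T : {vspace 'cV[scalar_field R F]_n})
    (A_selfadjoint : adjmx A = A)
    (A_eig : eigendecomposition A X lam)
    (lt_jh : (j < h)%N) (lt_hk : (h < k)%N)
    (le_k_rank : (k <= \rank A)%N) (lt_kn : (k < n)%N)
    (gap_j : (eigval lam j.+1 < eigval lam j)%E)
    (gap_k : (eigval lam k.+1 < eigval lam k)%E)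
    (le_hT : (h <= \dim T)%N)
    (angles_lt : all (fun th => th < pi / 2) (Theta (leading_span X k) T))
    (nu : 'M[scalar_field R F]_n -> R)
    (nu_norm : unitarily_invariant_norm nu) :
  adm_dist nu (Lambda_adm X j h k) T
    <= nu (sinTheta (leading_span X j) T) + nu (sinTheta (leading_span X k) T).
Proof.
have [nu_ge0 _ _ nuD _] := nu_norm; have [_ uX _] := A_eig.
(* The infimum is over a set bounded below by [0], so any admissible [S] bounds the distance. *)
have bound S : S \in Lambda_adm X j h k ->
    adm_dist nu (Lambda_adm X j h k) T <= nu (sinTheta S T).
  rewrite inE => admS; apply: ge_inf; last by exists S.
  by exists 0 => _ [S' _ <-]; exact: nu_ge0.
have lt_hn := ltn_trans lt_hk lt_kn; have lt_jn := ltn_trans lt_jh lt_hn.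
have dimX l : (l < n)%N -> \dim (leading_span X l) = l.
  by move=> /ltnW; exact: dim_leading_span.
have [Pj pPj] := projector_exists (leading_span X j).
have [Pk pPk] := projector_exists (leading_span X k).
have [Q pQ] := projector_exists T.
have [le_kT|lt_Tk] := leqP k (\dim T).
  apply: (@le_trans _ _ (nu (sinTheta (leading_span X h) T))).
    apply: bound; rewrite inE; split; first exact: dimX.
    - by apply: leading_span_mono; exact: ltnW.
    - by apply: leading_span_mono; exact: ltnW.
  (* The [X_j] term is nonnegative; the [X_k] term alone dominates. *)
  rewrite -[leLHS]add0r lerD //.
  have [Ph pPh] := projector_exists (leading_span X h).
  rewrite (norm_sinTheta nu_norm _ pPh pQ) ?dimX //.
  rewrite (norm_sinTheta nu_norm _ pPk pQ) ?dimX //.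
  have <- := projector_absorb pPh pPk (leading_span_mono X (ltnW lt_hk)).
  by rewrite mulmxA (norm_mul_projector nu_norm _ pPh).
pose T' := (linfun (mulmx Pk) @: T)%VS.
have le_TX : (\dim T <= \dim (leading_span X k))%N by rewrite dimX // ltnW.
(* The angle condition makes [Pk] injective on [T]. *)
have dimT' : \dim T' = \dim T.
  apply: limg_dim_eq; apply/eqP; rewrite -subv0; apply/subvP => v.
  rewrite memv_cap memv_lker_mulmx memv0 => /andP[vT /eqP Pv].
  by rewrite (projector_kernel_trivial pPk le_TX angles_lt vT Pv).
have [Q' pQ'] := projector_exists T'.
(* Rank-nullity for [Pj] on [T']: the image lies in [X_j], of dimension [j], so the kernel has
   dimension at least [dim T - j >= h - j]. *)
have [|S' S'sub dimS'] :=
    @subspace_of_dim _ _ _ (T' :&: lker (linfun (mulmx Pj)))%VS (h - j).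
  rewrite leq_subLR addnC -(leq_add2r (\dim (linfun (mulmx Pj) @: T')%VS)).
  rewrite addnAC limg_ker_dim dimT' leq_add //.
  rewrite -[leqRHS](dimX j lt_jn) dimvS //; apply/subvP => _ /memv_imgP[w _ ->].
  by rewrite lfunE; case: pPj => _ + _; exact.
have [S'T' S'K] : (S' <= T')%VS /\ (S' <= lker (linfun (mulmx Pj)))%VS.
  by apply/andP; rewrite -subv_cap.
have [P' pP'] := projector_exists S'.
have pS := projector_add pPj pP' S'K.
have dimS : \dim (leading_span X j + S') = h.
  by rewrite (dim_add_ker pPj S'K) dimX // dimS' subnKC // ltnW.
apply: (le_trans (bound (leading_span X j + S')%VS _)).
  rewrite inE; split=> //; first exact: addvSl.
  rewrite subv_add leading_span_mono ?(ltnW (ltn_trans lt_jh lt_hk)) //=.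
  apply: subv_trans S'T' _; apply/subvP => _ /memv_imgP[w _ ->].
  by rewrite lfunE; case: pPk => _ + _; exact.
(* The projector onto [X_j + S'] is [Pj + P']; the triangle inequality separates the two
   contributions. *)
rewrite (norm_sinTheta nu_norm _ pS pQ) ?dimS // mulmxDr (le_trans (nuD _ _)) //.
rewrite (norm_sinTheta nu_norm _ pPj pQ) ?dimX ?(leq_trans (ltnW lt_jh)) // lerD2l.
rewrite (norm_sinTheta_image nu_norm pPk pQ le_TX dimT' pQ').
(* As [P' = Q' P'], the second contribution is [(1 - Q) Q'] times a projector. *)
have <- := projector_absorb pP' pQ' S'T'.
by rewrite mulmxA (norm_mul_projector nu_norm _ pP').
Qed.
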